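(* Let $k$ be a field, let $G$ be a finite group, and let $M_n,\dots,M_1$ ($n\ge 1$) be a sequence of $kG$-modules which are finite dimensional as $k$-vector spaces. For each pair $n\ge j\ge i\ge 1$ fix a space of irreducible invariants $(M_j\otimes\cdots\otimes M_i)^G_{\mathsf{irr}}$. Then the linear map $$\psi_{M_n,\dots,M_1}:\bigoplus_{p}\,(M_n\otimes\cdots\otimes M_1)^G_{p,\mathsf{irr}}\longrightarrow (M_n\otimes\cdots\otimes M_1)^G,$$ where $p$ runs over all non-ordered partitions of $n$, is bijective.
   Context: Tensor products are over the field $k$ (of any characteristic), and $G$ acts diagonally on tensor products of $kG$-modules: $s(v\otimes v')=sv\otimes sv'$. $(-)^G$ denotes the subspace of $G$-fixed vectors. For $n\ge j\ge i\ge 1$, the space of composite invariants $\left[(M_j\otimes\cdots\otimes M_i)^G\right]^2$ is the subspace of $(M_j\otimes\cdots\otimes M_i)^G$ given by the sum over $l=i,\dots,j-1$ of the images of the canonical maps $$(M_j\otimes\cdots\otimes M_{l+1})^G\otimes(M_l\otimes\cdots\otimes M_i)^G\to(M_j\otimes\cdots\otimes M_i)^G .$$ (It is $0$ if $i=j$.) A space of irreducible invariants $(M_j\otimes\cdots\otimes M_i)^G_{\mathsf{irr}}$ is an arbitrarily chosen vector space complement of $\left[(M_j\otimes\cdots\otimes M_i)^G\right]^2$ in $(M_j\otimes\cdots\otimes M_i)^G$; in particular $(M_i)^G_{\mathsf{irr}}=M_i^G$. A non-ordered ($l$-)partition of $n$ is a sequence $p=(n_l,\dots,n_1)$ of $l\ge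 1$ positive integers with $n=n_l+\cdots+n_1$ (different sequences are different partitions). Put $$(M_n\otimes\cdots\otimes M_1)^G_{p,\mathsf{irr}}=(M_n\otimes\cdots\otimes M_{n_1+\cdots+n_{l-1}+1})^G_{\mathsf{irr}}\otimes\cdots\otimes(M_{n_1+n_2}\otimes\cdots\otimes M_{n_1+1})^G_{\mathsf{irr}}\otimes(M_{n_1}\otimes\cdots\otimes M_1)^G_{\mathsf{irr}},$$ let $\psi_p:(M_n\otimes\cdots\otimes M_1)^G_{p,\mathsf{irr}}\to(M_n\otimes\cdots\otimes M_1)^G$ be the canonical (tensoring) map, and let $\psi_{M_n,\dots,M_1}=\sum_p\psi_p$ be the sum over all non-ordered partitions $p$ of $n$. *)

(* Defs.v *)
From HB Require Import structures.
From Stdlib Require Import FunctionalExtensionality.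
From mathcomp Require Import all_boot all_order all_fingroup all_algebra.

Set Implicit Arguments.
Unset Strict Implicit.
Unset Printing Implicit Defensive.

Import GRing.Theory.
Local Open Scope ring_scope.

(** * Tensor product of a finite family of finite dimensional vector spaces

   [tens V] is the tensor product of the family [V], realised as the space of
   coordinate arrays with respect to the bases [vbasis {:V i}].  Its universal
   property, with universal multilinear map [ptens], is [ptens_multilinear],
   [tliftE] and [tens_homP]. *)
Section Tensor.

Variables (k : fieldType) (I : finType).

Section Family.

Variable V : I -> vectType k.

Definition mindex : finType := {dffun forall i, 'I_(\dim {:V i})}.

Definition tens : vectType k := {ffun mindex -> k^o}.

Definition tens_coef (t : tens) : mindex -> k := (t : {ffun mindex -> k^o}).

Definition ptens (v : forall i, V i) : tens :=
  [ffun x : mindex => \prod_i coord (vbasis {:V i}) (x i) (v i) : k^o].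

Definition basis_tuple (x : mindex) (i : I) : V i := (vbasis {:V i})`_(x i).

Definition multilinear (W : lmodType k) (f : (forall i, V i) -> W) : Prop :=
  forall (v : forall i, V i) (i : I) (a : k) (x y : V i),
    f (dfwith v (a *: x + y)) = a *: f (dfwith v x) + f (dfwith v y).

(* The linear map induced by [f]; meaningful for multilinear [f], see [tliftE]. *)
Definition tlift (W : vectType k) (f : (forall i, V i) -> W) : 'Hom(tens, W) :=
  linfun (fun t => \sum_(x : mindex) tens_coef t x *: f (basis_tuple x)).

Fact tlift_is_linear (W : vectType k) (f : (forall i, V i) -> W) :
  linear (fun t : tens => \sum_(x : mindex) tens_coef t x *: f (basis_tuple x)).
Proof.
move=> a s t; rewrite scaler_sumr -big_split; apply: eq_bigr => x _ /=.
by rewrite /tens_coef !ffunE scalerDl scalerA.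
Qed.

Lemma tlift_sum (W : vectType k) (f : (forall i, V i) -> W) t :
  tlift f t = \sum_(x : mindex) tens_coef t x *: f (basis_tuple x).
Proof.
pose L := GRing.isLinear.Build _ _ _ _ _ (tlift_is_linear f).
pose g : {linear tens -> W} := HB.pack
  (fun t : tens => \sum_(x : mindex) tens_coef t x *: f (basis_tuple x)) L.
exact: (lfunE g).
Qed.

Lemma ptensE (v : forall i, V i) (x : mindex) :
  tens_coef (ptens v) x = \prod_i coord (vbasis {:V i}) (x i) (v i).
Proof. exact: ffunE. Qed.

Lemma ptens_multilinear : multilinear ptens.
Proof.
move=> v i a x y; apply/ffunP=> z.
have prodE (w : V i) : tens_coef (ptens (dfwith v w)) z =
    coord (vbasis {:V i}) (z i) w *
    \prod_(j | j != i) coord (vbasis {:V j}) (z j) (v j).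
  rewrite ptensE (bigD1 i) //= dfwith_in; congr (_ * _).
  by apply: eq_bigr => j ji; rewrite dfwith_out // eq_sym.
transitivity (a * tens_coef (ptens (dfwith v x)) z
              + tens_coef (ptens (dfwith v y)) z); last first.
  by rewrite [RHS]ffunE [X in _ = X + _]ffunE.
by rewrite -[LHS]/(tens_coef _ z) !prodE linearP mulrDl mulrA.
Qed.

Lemma ptens_basis x :
  ptens (basis_tuple x) = [ffun y : mindex => (y == x)%:R : k^o].
Proof.
have cE y i : coord (vbasis {:V i}) (y i) (basis_tuple x i) = (y i == x i)%:R.
  by rewrite coord_free ?(basis_free (vbasisP _)) // eq_sym.
apply/ffunP=> y; rewrite !ffunE; have [->|yx] := eqVneq y x.
  by rewrite big1 // => i _; rewrite cE eqxx.
have /existsP[i yi] : [exists i, y i != x i].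
  apply: contraNT yx; rewrite negb_exists => /forallP e.
  by apply/eqP/ffunP=> i; apply/eqP; rewrite -[_ == _]negbK; apply: e.
by rewrite (bigD1 i) //= cE (negPf yi) mul0r.
Qed.

Lemma tlift_basis (W : vectType k) (f : (forall i, V i) -> W) x :
  tlift f (ptens (basis_tuple x)) = f (basis_tuple x).
Proof.
rewrite tlift_sum ptens_basis (bigD1 x) //= /tens_coef ffunE eqxx scale1r.
by rewrite big1 ?addr0 // => y yx; rewrite ffunE (negPf yx) scale0r.
Qed.

Lemma tens_sum (t : tens) :
  t = \sum_(x : mindex) tens_coef t x *: ptens (basis_tuple x).
Proof.
apply/ffunP=> y; rewrite sum_ffunE (bigD1 y) //= big1 ?addr0.
  by rewrite ptens_basis !ffunE eqxx [_ *: _]mulr1.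
by move=> x xy; rewrite ptens_basis !ffunE eq_sym (negPf xy) scaler0.
Qed.

Lemma tens_homP (W : vectType k) (g h : 'Hom(tens, W)) :
  (forall v, g (ptens v) = h (ptens v)) -> g = h.
Proof.
move=> gh; apply/lfunP=> t.
rewrite [t]tens_sum.
rewrite 2!linear_sum; apply: eq_bigr => x _; rewrite [LHS]linearZ [RHS]linearZ.
by congr (_ *: _); apply: gh.
Qed.

(* Multilinear maps agreeing on a family of generators are equal. *)
Lemma multilinear_ext (W : lmodType k) (S : forall i, V i -> Prop)
    (f g : (forall i, V i) -> W) :
    (forall i (v : V i), exists (J : finType) (c : J -> k) (e : J -> V i),
       (forall j, S i (e j)) /\ v = \sum_j c j *: e j) ->
    multilinear f -> multilinear g ->
    (forall v, (forall i, S i (v i)) -> f v = g v) ->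
  forall v, f v = g v.
Proof.
move=> gen fl gl fg.
have lsum (h : (forall i, V i) -> W) : multilinear h -> forall v i
    (J : finType) (c : J -> k) (e : J -> V i),
    h (dfwith v (\sum_j c j *: e j)) = \sum_j c j *: h (dfwith v (e j)).
  move=> hl v i J c e; have h0 : h (dfwith v (0 : V i)) = 0.
    have := hl v i 1 0 0; rewrite scaler0 addr0 scale1r => h2.
    by apply: (addrI (h (dfwith v (0 : V i)))); rewrite addr0 -h2.
  elim: (index_enum J) => [|j r IH]; first by rewrite !big_nil.
  by rewrite !big_cons hl IH.
suff ext (s : seq I) v : (forall i, i \notin s -> S i (v i)) -> f v = g v.
  by move=> v; apply: (ext (enum I)) => i; rewrite mem_enum.
elim: s v => [|i s IH] v Sv; first by apply: fg => i; apply: Sv.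
have [J [c [e [Se ve]]]] := gen i (v i).
have {ve} ->: v = dfwith v (\sum_j c j *: e j).
  by apply: functional_extensionality_dep => j; case: dfwithP.
rewrite (lsum _ fl) (lsum _ gl); apply: eq_bigr => j _; congr (_ *: _).
apply: IH => l ls; have [<-|il] := eqVneq i l; first by rewrite dfwith_in.
by rewrite dfwith_out //; apply: Sv; rewrite inE negb_or eq_sym il.
Qed.

Lemma tlift_multilinear (W : vectType k) (f : (forall i, V i) -> W) :
  multilinear (fun v => tlift f (ptens v)).
Proof. by move=> v i a x y /=; rewrite ptens_multilinear linearP. Qed.

Lemma tliftE (W : vectType k) (f : (forall i, V i) -> W) :
  multilinear f -> forall v, tlift f (ptens v) = f v.
Proof.
move=> fl; pose S i (w : V i) := exists j : 'I_(\dim {:V i}),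
  w = (vbasis {:V i})`_j.
apply: (multilinear_ext (S := S)) => // [i w||v Sv].
- exists 'I_(\dim {:V i}), (fun j => coord (vbasis {:V i}) j w).
  exists (fun j : 'I_(\dim {:V i}) => (vbasis {:V i})`_j); split=> [j|]; first by exists j.
  exact/coord_vbasis/memvf.
- exact: tlift_multilinear.
have [x xE] := fin_all_exists Sv.
have -> : v = basis_tuple (finfun x : mindex).
  by apply: functional_extensionality_dep => i; rewrite xE /basis_tuple ffunE.
exact: tlift_basis.
Qed.

Lemma tens_gen (t : tens) : exists (J : finType) (c : J -> k) (e : J -> tens),
  (forall j, exists v, e j = ptens v) /\ t = \sum_j c j *: e j.
Proof.
exists mindex, (tens_coef t), (fun x => ptens (basis_tuple x)).
by split=> [x|]; [exists (basis_tuple x) | apply: tens_sum].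
Qed.

End Family.

Definition tens_map (V W : I -> vectType k) (phi : forall i, 'Hom(V i, W i)) :
    'Hom(tens V, tens W) :=
  tlift (fun v : forall i, V i => ptens (fun i => phi i (v i))).

Lemma tens_mapE (V W : I -> vectType k) (phi : forall i, 'Hom(V i, W i)) v :
  tens_map phi (ptens v) = ptens (fun i => phi i (v i)).
Proof.
apply: (tliftE (f := fun v : forall i, V i => ptens (fun i => phi i (v i)))).
move=> {}v i a x y.
have E (w : V i) : (fun j => phi j (dfwith v w j)) =
    dfwith (fun j => phi j (v j)) (phi i w).
  apply: functional_extensionality_dep => j; have [<-|ij] := eqVneq i j.
    by rewrite !dfwith_in.
  by rewrite !dfwith_out.
by rewrite !E linearP ptens_multilinear.
Qed.

End Tensor.

Section Merge.

Variables (k : fieldType) (I : finType) (V : I -> vectType k).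

Definition subfam (A : {set I}) (l : {l | l \in A}) : vectType k := V (val l).
Definition tensOn (A : {set I}) : vectType k := tens (@subfam A).

Variables (C : {set I}) (B : finType) (A : B -> {set I}).

Definition incl (D : {set I}) (sDC : D \subset C) (l : {l | l \in D}) :
  {l | l \in C} := exist _ (val l) (subsetP sDC _ (valP l)).

Definition mrestr (D : {set I}) (sDC : D \subset C)
    (x : mindex (@subfam C)) : mindex (@subfam D) :=
  [ffun l => x (incl sDC l)].

Hypothesis sAC : forall b, A b \subset C.

(* When the [A b] partition [C], this is the multilinear map sending
   [fun b => ptens (v restricted to A b)] to [ptens v], see [merge_ptens]. *)
Definition merge (u : forall b, tensOn (A b)) : tensOn C :=
  [ffun x : mindex (@subfam C) =>
     \prod_b tens_coef (u b) (mrestr (sAC b) x) : k^o].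

(* The canonical map from the tensor product of the [U b] to that of the family
   over [C]. *)
Definition canon (U : forall b, {vspace tensOn (A b)}) :
    'Hom(tens (fun b => subvs_of (U b)), tensOn C) :=
  tlift (fun u : forall b, subvs_of (U b) => merge (fun b => vsval (u b))).

Lemma merge_multilinear : multilinear merge.
Proof.
move=> u b a s t; apply/ffunP=> x.
have prodE (w : tensOn (A b)) : tens_coef (merge (dfwith u w)) x =
    tens_coef w (mrestr (sAC b) x) *
    \prod_(c | c != b) tens_coef (u c) (mrestr (sAC c) x).
  rewrite [LHS]ffunE (bigD1 b) //= dfwith_in; congr (_ * _).
  by apply: eq_bigr => c cb; rewrite dfwith_out // eq_sym.
transitivity (a * tens_coef (merge (dfwith u s)) x
              + tens_coef (merge (dfwith u t)) x); last first.
  by rewrite [RHS]ffunE [X in _ = X + _]ffunE.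
rewrite -[LHS]/(tens_coef _ x) !prodE mulrA -mulrDl; congr (_ * _).
by rewrite /tens_coef [LHS]ffunE [X in X + _]ffunE.
Qed.

Lemma canonE U (u : forall b, subvs_of (U b)) :
  canon U (ptens u) = merge (fun b => vsval (u b)).
Proof.
apply: (tliftE (f := fun u : forall b, subvs_of (U b) =>
  merge (fun b => vsval (u b)))) => {}u b a x y.
have E (w : subvs_of (U b)) : (fun c => vsval (dfwith u w c)) =
    dfwith (fun c => vsval (u c)) (vsval w).
  apply: functional_extensionality_dep => c; have [<-|bc] := eqVneq b c.
    by rewrite !dfwith_in.
  by rewrite !dfwith_out.
by rewrite !E linearP merge_multilinear.
Qed.

Hypothesis A_cover : forall i, i \in C -> exists b, i \in A b.
Hypothesis A_disj : forall b c i, i \in A b -> i \in A c -> b = c.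

Lemma merge_ptens (v : forall l, @subfam C l) :
  merge (fun b => ptens (fun l : {l | l \in A b} => v (incl (sAC b) l)))
  = ptens v.
Proof.
apply/ffunP=> x; rewrite [RHS]ffunE [LHS]ffunE.
pose F l := coord (vbasis {:subfam l}) (x l) (v l).
transitivity (\prod_b \prod_(l : {l | l \in A b}) F (incl (sAC b) l)).
  apply: eq_bigr => b _; rewrite ptensE; apply: eq_bigr => l _.
  by rewrite ffunE.
have blk (l : {l | l \in C}) : exists b, val l \in A b by apply/A_cover/valP.
pose g (p : {b : B & {l | l \in A b}}) := incl (sAC (tag p)) (tagged p).
pose h (l : {l | l \in C}) : {b : B & {l | l \in A b}} :=
  Tagged (fun b => {l | l \in A b})
    (exist (fun i => i \in A (xchoose (blk l))) (val l) (xchooseP (blk l))).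
rewrite sig_big_dep /= [RHS](reindex g) //=.
exists h => [[b l]|l] _; last exact/val_inj.
rewrite /h /g /=.
move: (xchoose _) (xchooseP _) => c cP.
have E := A_disj (valP l) cP; subst c.
by congr Tagged; apply/val_inj.
Qed.

Lemma glue (w : forall b, forall l, @subfam (A b) l) :
  exists v : forall l, @subfam C l, forall b l, w b l = v (incl (sAC b) l).
Proof.
have blk (l : {l | l \in C}) : exists b, val l \in A b by apply/A_cover/valP.
exists (fun l => w (xchoose (blk l)) (exist _ (val l) (xchooseP (blk l)))).
move=> b l; move: (xchoose _) (xchooseP _) => c cP.
have E := A_disj (valP l) cP; subst c.
by case: l cP => i iA iA' /=; rewrite (bool_irrelevance iA' iA).
Qed.

End Merge.


Record kGmodule (k : fieldType) (G : finGroupType) := KGModule {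
  kGsort :> vectType k;
  act : G -> 'End(kGsort);
  act1 : act 1%g = \1%VF;
  actM : forall s t : G, act (s * t)%g = (act s \o act t)%VF
}.

Section Invariants.

Variables (k : fieldType) (G : finGroupType) (I : finType).
Variable M : I -> kGmodule k G.

Definition diag_act (A : {set I}) (s : G) : 'End(tensOn M A) :=
  tens_map (fun l : {l | l \in A} => act (M (val l)) s
              : 'Hom(subfam M l, subfam M l)).

Definition invariants (A : {set I}) : {vspace tensOn M A} :=
  (\bigcap_(s : G) fixedSpace (diag_act A s))%VS.

Lemma invariantsP A (t : tensOn M A) :
  reflect (forall s, diag_act A s t = t) (t \in invariants A).
Proof.
apply: (iffP idP) => [tI s|tI].
  by apply/fixedSpaceP; move: t tI; apply/subvP/bigcapv_inf.
by rewrite memvE; apply/subv_bigcapP => s _; rewrite -memvE; apply/fixedSpaceP.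
Qed.

Section Canon.

Variables (C : {set I}) (B : finType) (A : B -> {set I}).
Hypothesis sAC : forall b, A b \subset C.
Hypothesis A_cover : forall i, i \in C -> exists b, i \in A b.
Hypothesis A_disj : forall b c i, i \in A b -> i \in A c -> b = c.

Lemma diag_act_merge s (u : forall b, tensOn M (A b)) :
  diag_act C s (merge sAC u) = merge sAC (fun b => diag_act (A b) s (u b)).
Proof.
pose S b (t : tensOn M (A b)) := exists v, t = ptens v.
move: u; apply: (multilinear_ext (S := S)) => [b t|u b a x y|u b a x y|u Su].
- exact: tens_gen.
- by rewrite merge_multilinear linearP.
- have E (w : tensOn M (A b)) : (fun c => diag_act (A c) s (dfwith u w c)) =
      dfwith (fun c => diag_act (A c) s (u c)) (diag_act (A b) s w).
    apply: functional_extensionality_dep => c; have [<-|bc] := eqVneq b c.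
      by rewrite !dfwith_in.
    by rewrite !dfwith_out.
  by rewrite !E linearP merge_multilinear.
have [w uE] := fin_all_exists Su.
have [v wE] := glue sAC A_cover A_disj w.
have -> : u = fun b => ptens (fun l : {l | l \in A b} => v (incl (sAC b) l)).
  apply: functional_extensionality_dep => b; rewrite uE; congr ptens.
  by apply: functional_extensionality_dep => l; rewrite wE.
rewrite merge_ptens // [LHS]tens_mapE -(merge_ptens sAC) //; congr merge.
by apply: functional_extensionality_dep => b; rewrite [RHS]tens_mapE.
Qed.

Lemma canon_invariants (U : forall b, {vspace tensOn M (A b)}) :
    (forall b, (U b <= invariants (A b))%VS) ->
  forall t, canon sAC U t \in invariants C.
Proof.
move=> UI t; rewrite [canon _ _ _]tlift_sum.
apply: memv_suml => x _; apply: memvZ; apply/invariantsP => s.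
rewrite diag_act_merge; congr merge; apply: functional_extensionality_dep => b.
by apply/invariantsP/(subvP (UI b))/subvsP.
Qed.

End Canon.
End Invariants.

Section DirectSum.

Variables (k : fieldType) (P : finType) (V : P -> vectType k).

Definition dirsum : Type := {dffun forall p, V p}.

HB.instance Definition _ := Choice.copy dirsum {dffun forall p, V p}.

Definition dirsum_fun (t : dirsum) : forall p, V p :=
  (t : {dffun forall p, V p}).
Definition mk_dirsum (f : forall p, V p) : dirsum :=
  [ffun p => f p] : {dffun forall p, V p}.

Lemma mk_dirsumE f p : dirsum_fun (mk_dirsum f) p = f p.
Proof. exact: ffunE. Qed.

Lemma dirsumP (t u : dirsum) :
  (forall p, dirsum_fun t p = dirsum_fun u p) -> t = u.
Proof. by move=> tu; apply/ffunP. Qed.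

Definition dirsum_add t u :=
  mk_dirsum (fun p => dirsum_fun t p + dirsum_fun u p).
Definition dirsum_opp t := mk_dirsum (fun p => - dirsum_fun t p).
Definition dirsum_zero := mk_dirsum (fun p => 0).
Definition dirsum_scale (a : k) t := mk_dirsum (fun p => a *: dirsum_fun t p).

Fact dirsum_addA : associative dirsum_add.
Proof. by move=> t u v; apply: dirsumP => p; rewrite !mk_dirsumE addrA. Qed.
Fact dirsum_addC : commutative dirsum_add.
Proof. by move=> t u; apply: dirsumP => p; rewrite !mk_dirsumE addrC. Qed.
Fact dirsum_add0 : left_id dirsum_zero dirsum_add.
Proof. by move=> t; apply: dirsumP => p; rewrite !mk_dirsumE add0r. Qed.
Fact dirsum_addN : left_inverse dirsum_zero dirsum_opp dirsum_add.
Proof. by move=> t; apply: dirsumP => p; rewrite !mk_dirsumE addNr. Qed.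
HB.instance Definition _ := GRing.isZmodule.Build dirsum
  dirsum_addA dirsum_addC dirsum_add0 dirsum_addN.

Fact dirsum_scaleA a b t :
  dirsum_scale a (dirsum_scale b t) = dirsum_scale (a * b) t.
Proof. by apply: dirsumP => p; rewrite !mk_dirsumE scalerA. Qed.
Fact dirsum_scale1 : left_id 1 dirsum_scale.
Proof. by move=> t; apply: dirsumP => p; rewrite !mk_dirsumE scale1r. Qed.
Fact dirsum_scaleDr : right_distributive dirsum_scale +%R.
Proof. by move=> a t u; apply: dirsumP => p; rewrite !mk_dirsumE scalerDr. Qed.
Fact dirsum_scaleDl t : {morph dirsum_scale^~ t : a b / a + b}.
Proof. by move=> a b; apply: dirsumP => p; rewrite !mk_dirsumE scalerDl. Qed.
HB.instance Definition _ := GRing.Zmodule_isLmodule.Build k dirsum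
  dirsum_scaleA dirsum_scale1 dirsum_scaleDr dirsum_scaleDl.

End DirectSum.


(* [parts p] lists [n_1, ..., n_l] in this order, so the component of index
   [b : 'I_(size (parts p))] is [n_(b+1)].  Lengths and parts of compositions of
   [n] are at most [n], whence the ambient finite type; [parts_surj] shows that
   no composition is lost. *)
Section Compositions.

Variable n : nat.

Definition is_composition (s : seq nat) : bool :=
  all (fun a => 0 < a)%N s && (sumn s == n).

Definition composition : finType :=
  {p : n.-bseq 'I_n.+1 | is_composition (map val p)}.

Definition parts (p : composition) : seq nat := map val (val p).

Lemma parts_inj : injective parts.
Proof. by move=> p q /(inj_map val_inj) /val_inj /val_inj. Qed.

Lemma parts_surj (s : seq nat) : is_composition s -> exists p, parts p = s.
Proof.
move=> sP; have /andP[s_gt0 /eqP s_sum] := sP.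
have s_lt : all (fun a => a < n.+1)%N s.
  rewrite -s_sum; apply/allP => a; elim: {sP s_gt0 s_sum} s => //= b s IH.
  by rewrite inE ltnS => /predU1P[->|/IH]; [apply: leq_addr|
    rewrite ltnS => /leq_trans; apply; apply: leq_addl].
have s_size : (size s <= n)%N.
  rewrite -s_sum; elim: {sP s_sum s_lt} s s_gt0 => //= a s IH /andP[a0 /IH].
  by move=> sz; apply: leq_ltn_trans sz _; rewrite -[ltnLHS]add0n ltn_add2r.
pose s' : seq 'I_n.+1 := map inord s.
have s'E : map val s' = s.
  rewrite -map_comp; apply: map_id_in => a /(allP s_lt) a_lt /=.
  by rewrite inordK.
have sz' : (size s' <= n)%N by rewrite size_map.
have s'P : is_composition (map val (Bseq sz')) by rewrite /= s'E.
by exists (exist _ (Bseq sz') s'P).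
Qed.

Variable p : composition.

(* [n_1 + ... + n_(b+1)] and [n_1 + ... + n_b + 1] *)
Definition top (b : nat) : nat := sumn (take b.+1 (parts p)).
Definition bot (b : nat) : nat := (sumn (take b (parts p))).+1.

Lemma sumn_parts : sumn (parts p) = n.
Proof. by have /andP[_ /eqP] := valP p. Qed.

Lemma topE b : (b < size (parts p))%N ->
  top b = (sumn (take b (parts p)) + nth 0 (parts p) b)%N.
Proof. by move=> bs; rewrite /top (take_nth 0%N) // sumn_rcons. Qed.

Lemma bot_le_top (b : 'I_(size (parts p))) : (bot b <= top b)%N.
Proof.
have /andP[/allP p0 _] := valP p.
by rewrite topE // /bot -addn1 leq_add2l; apply/p0/mem_nth.
Qed.

Lemma top_le b : (top b <= n)%N.
Proof.
rewrite -[leqRHS]sumn_parts -[X in (_ <= sumn X)%N](cat_take_drop b.+1).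
by rewrite sumn_cat leq_addr.
Qed.

Lemma sumn_take_le (s : seq nat) a b :
  (a <= b)%N -> (sumn (take a s) <= sumn (take b s))%N.
Proof.
by move=> ab; rewrite -(subnKC ab) takeD sumn_cat leq_addr.
Qed.

(* The intervals [bot b, top b] partition [1, n]. *)
Lemma parts_cover i : (0 < i <= n)%N ->
  exists b : 'I_(size (parts p)), (bot b <= i <= top b)%N.
Proof.
move=> /andP[i0 i_le].
have ex : exists m, (i <= sumn (take m (parts p)))%N.
  by exists (size (parts p)); rewrite take_size sumn_parts.
case: (ex_minnP ex) => [[|m]]; first by rewrite take0 leqNgt i0.
move=> im min; have m_lt : (m < size (parts p))%N.
  rewrite ltnNge; apply/negP => le_m.
  have: (i <= sumn (take m (parts p)))%N.
    by rewrite take_oversize // sumn_parts.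
  by move/min; rewrite ltnn.
exists (Ordinal m_lt); rewrite /top im andbT /bot ltnNge.
by apply/negP => /min; rewrite ltnn.
Qed.

Lemma parts_disj (b c : 'I_(size (parts p))) i :
  (bot b <= i <= top b)%N -> (bot c <= i <= top c)%N -> b = c.
Proof.
have le (x y : 'I_(size (parts p))) :
    (bot x <= i <= top x)%N -> (bot y <= i <= top y)%N -> (x <= y)%N.
  move=> /andP[xi _] /andP[_ iy]; rewrite leqNgt; apply/negP => yx.
  have := leq_trans xi (leq_trans iy (sumn_take_le _ yx)).
  by rewrite ltnn.
by move=> bi ci; apply/val_inj/eqP; rewrite eqn_leq !le.
Qed.

End Compositions.

Section Irreducible.

Variables (k : fieldType) (G : finGroupType) (n : nat).

(* The module written [M_l] on paper, [1 <= l <= n], is [M] at the ordinal of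
   value [l - 1]; [seg j i] is the index set [{j, ..., i}]. *)
Variable M : 'I_n -> kGmodule k G.

Definition seg (j i : nat) : {set 'I_n} := [set l : 'I_n | (i <= l.+1 <= j)%N].

(* M_j (x) ... (x) M_i and its invariants *)
Definition tensM (j i : nat) : vectType k := tensOn M (seg j i).
Definition invM (j i : nat) : {vspace tensM j i} := invariants M (seg j i).

Definition cut (j i l : nat) (b : bool) : {set 'I_n} :=
  if b then seg j l.+1 else seg l i.

Lemma cut_sub (j i : nat) (l : {l : 'I_j | (i <= l)%N}) b :
  cut j i (val l) b \subset seg j i.
Proof.
case: l b => l il [] /=; apply/subsetP => m; rewrite !inE => /andP[m1 m2].
  by rewrite m2 (leq_trans il (leq_trans (leqnSn _) m1)).
by rewrite m1 (leq_trans m2 (ltnW (ltn_ord l))).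
Qed.

(* The sum over [l = i, ..., j-1] of the images of the canonical maps
   (M_j..M_(l+1))^G (x) (M_l..M_i)^G -> M_j (x) ... (x) M_i. *)
Definition composite (j i : nat) : {vspace tensM j i} :=
  (\sum_(l : {l : 'I_j | (i <= l)%N})
     limg (canon (cut_sub l) (fun b => invariants M (cut j i (val l) b))))%VS.

Lemma composite_sub (j i : nat) : (composite j i <= invM j i)%VS.
Proof.
apply/subv_sumP => l _; apply/subvP => _ /memv_imgP[t _ ->].
apply: canon_invariants => // [m|b c m].
  rewrite inE => /andP[im mj]; case: (leqP m.+1 (val l)) => lm.
    by exists false; rewrite inE im lm.
  by exists true; rewrite inE lm mj.
by case: b c => [] [] //; rewrite !inE => /andP[h1 h2] /andP[h3 h4];
  [have := leq_trans h1 h4 | have := leq_trans h3 h2]; rewrite ltnn.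
Qed.

(* A choice of irreducible invariants for every pair [n >= j >= i >= 1]
   (values at other pairs are irrelevant). *)
Record irr_choice := IrrChoice {
  irr :> forall j i : nat, {vspace tensM j i};
  irrP : forall j i, (1 <= i)%N -> (i <= j)%N -> (j <= n)%N ->
    (irr j i + composite j i = invM j i)%VS /\
    (irr j i :&: composite j i = 0)%VS
}.

Variable Irr : irr_choice.

Section Psi_p.

Variable p : composition n.

Definition block (b : 'I_(size (parts p))) : {set 'I_n} :=
  seg (top p b) (bot p b).

Definition irr_block (b : 'I_(size (parts p))) : {vspace tensOn M (block b)} :=
  Irr (top p b) (bot p b).

(* (M_n (x) ... (x) M_1)^G_(p,irr) *)
Definition tens_irr : vectType k := tens (fun b => subvs_of (irr_block b)).

Lemma block_sub b : block b \subset seg n 1.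
Proof. by apply/subsetP => l _; rewrite inE /=. Qed.

Lemma psi_p_invariant (t : tens_irr) : canon block_sub irr_block t \in invM n 1.
Proof.
apply: canon_invariants => [i|b c i|b].
- rewrite inE => /andP[_ i_le].
  have [|b bi] := @parts_cover n p i.+1; first exact: i_le.
  by exists b; rewrite inE.
- by rewrite !inE; apply: parts_disj.
have [] := irrP Irr (ltn0Sn _ : (1 <= bot p b)%N) (bot_le_top b) (top_le p b).
by move=> E _; rewrite -[invariants _ _]/(invM (top p b) (bot p b)) -E addvSl.
Qed.

Definition psi_p (t : tens_irr) : subvs_of (invM n 1) :=
  Subvs (psi_p_invariant t).

End Psi_p.

Definition psi (t : dirsum tens_irr) : subvs_of (invM n 1) :=
  \sum_(p : composition n) psi_p (dirsum_fun t p).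

Fact psi_p_is_linear p : linear (@psi_p p).
Proof. by move=> a s t; apply/val_inj; rewrite /= linearP. Qed.
HB.instance Definition _ p :=
  GRing.isLinear.Build k (tens_irr p) (subvs_of (invM n 1)) _ (@psi_p p)
    (@psi_p_is_linear p).

Fact psi_is_linear : linear psi.
Proof.
move=> a s t; rewrite /psi scaler_sumr -big_split; apply: eq_bigr => p _ /=.
by rewrite -linearP /=; congr psi_p; rewrite mk_dirsumE mk_dirsumE.
Qed.
HB.instance Definition _ :=
  GRing.isLinear.Build k (dirsum tens_irr) (subvs_of (invM n 1)) _ psi
    psi_is_linear.

End Irreducible.

Arguments psi {k G n M} Irr t.
Arguments psi_p {k G n M} Irr p t.
Arguments tens_irr {k G n M} Irr p.

(* Main.v *)
(* A tensor over a set A of factors is encoded as a scalar function on a common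
   space of points that depends on the coordinates in A only; the tensor product
   of two tensors is then a pointwise product, associative on the nose.

   Write T(a,b), R(a,b), I(a,b) for the tensors, invariants and irreducible
   invariants of M_b (x) ... (x) M_(a+1).  The sum over a < b <= c of the spaces
   I(a,b) T(b,c) is direct, by induction on c: the terms with b < c form the sum
   for c - 1, tensored with T(c-1,c), and the action, which only affects the
   right factors, preserves each of them.  So an invariant element of their sum
   lies in the sum of the I(a,b) R(b,c), hence is composite, and cannot be a
   nonzero element of I(a,c).  Therefore R(a,c) is the direct sum of the
   I(a,b) R(b,c).  Iterating, R(0,n) is spanned by the products of irreducible
   invariants along compositions, and its dimension is the number of products of
   basis elements, so that these products form a basis. *)
From HB Require Import structures.
From Stdlib Require Import FunctionalExtensionality.
Require Import Defs.
From mathcomp Require Import all_boot all_order all_fingroup all_algebra.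

Set Implicit Arguments.
Unset Strict Implicit.
Unset Printing Implicit Defensive.

Import GRing.Theory.
Local Open Scope ring_scope.

(** * Products of subspaces in the algebra of scalar functions *)

Section ProductSpace.

Variables (k : fieldType) (X : finType).
Notation W := {ffun X -> k^o}.
Implicit Types (U V Z K : {vspace W}) (u v f g : W).

Lemma ffun_mulC f g : f * g = g * f.
Proof. by apply/ffunP => x; rewrite !ffunE mulrC. Qed.

Lemma ffun_scalerAl (a : k) f g : a *: (f * g) = (a *: f) * g.
Proof. by apply/ffunP => x; rewrite !ffunE; apply: mulrA. Qed.

Lemma ffun_scalerAr (a : k) f g : a *: (f * g) = f * (a *: g).
Proof. by rewrite ffun_mulC ffun_scalerAl ffun_mulC. Qed.

Lemma ffun_prodE (J : Type) (r : seq J) (f : J -> W) x :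
  (\prod_(j <- r) f j) x = \prod_(j <- r) f j x.
Proof.
elim: r => [|j r IH]; first by rewrite !big_nil ffunE.
by rewrite !big_cons ffunE IH.
Qed.

Lemma ffun_prod_bool (f : bool -> W) : \prod_b f b = f false * f true.
Proof.
by apply/ffunP => x; rewrite ffun_prodE big_bool !ffunE mulrC.
Qed.

(** For functions of disjoint sets of coordinates this is the tensor product of [U] and [V], see
    [dim_prodsp]. *)
Definition prodsp U V : {vspace W} :=
  <<[seq u * v | u <- vbasis U, v <- vbasis V]>>%VS.

Lemma mem_prodsp U V u v : u \in U -> v \in V -> u * v \in prodsp U V.
Proof.
move=> /coord_vbasis-> /coord_vbasis->; rewrite mulr_suml.
apply: memv_suml => i _; rewrite mulr_sumr; apply: memv_suml => j _.
rewrite -ffun_scalerAl -ffun_scalerAr; do 2 apply: memvZ.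
by apply/memv_span/allpairs_f; apply: mem_nth; rewrite size_tuple.
Qed.

Lemma mem_nth_vbasis U (t : 'I_(\dim U)) : (vbasis U)`_t \in U.
Proof. by rewrite vbasis_mem // mem_nth // size_tuple. Qed.

Lemma prodsp_subP U V K :
  (forall u v, u \in U -> v \in V -> u * v \in K) <-> (prodsp U V <= K)%VS.
Proof.
split=> [UVK|/subvP UVK u v uU vV]; last exact/UVK/mem_prodsp.
apply/span_subvP => _ /allpairsP[[u v] /= [uU vV ->]].
by apply: UVK; apply: vbasis_mem.
Qed.

Lemma prodspS U U' V V' :
  (U <= U')%VS -> (V <= V')%VS -> (prodsp U V <= prodsp U' V')%VS.
Proof.
move=> /subvP sU /subvP sV; apply/prodsp_subP => u v /sU uU /sV vV.
exact: mem_prodsp.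
Qed.

Lemma prodspC U V : prodsp U V = prodsp V U.
Proof.
by apply/subv_anti/andP; split; apply/prodsp_subP => u v uU vV;
  rewrite ffun_mulC mem_prodsp.
Qed.

Lemma prodsp1 U : prodsp U <[1 : W]> = U.
Proof.
apply/subv_anti/andP; split; last first.
  by apply/subvP => u uU; rewrite -[u]mulr1 mem_prodsp ?memv_line.
apply/prodsp_subP => u _ uU /vlineP[a ->].
by rewrite -ffun_scalerAr mulr1 memvZ.
Qed.

(** Collecting terms by the basis vectors of [V] yields coefficients in [U], to which [local_free]
    can be applied. The functions of this form are closed under sums and contain the generators. *)
Lemma prodsp_sumr U V f : f \in prodsp U V ->
  exists2 u : 'I_(\dim V) -> W,
    forall t, u t \in U & f = \sum_(t < \dim V) (u t * (vbasis V)`_t : W).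
Proof.
move=> fUV; rewrite (coord_span (X := in_tuple _) fUV).
pose P g := exists2 u : 'I_(\dim V) -> W,
    forall t, u t \in U & g = \sum_(t < \dim V) (u t * (vbasis V)`_t : W).
rewrite -/(P _).
have P0 : P 0.
  exists (fun=> 0) => [t|]; rewrite ?mem0v // big1 // => t _.
  by rewrite mul0r.
have PD g h : P g -> P h -> P (g + h).
  move=> [u uU ->] [v vU ->]; exists (fun t => u t + v t) => [t|].
    exact: memvD.
  by rewrite -big_split; apply: eq_bigr => t _; rewrite mulrDl.
elim/big_ind: _ => // i _.
have /allpairsP[[u v] /= [uU /(nthP 0)[j jV <-] ->]] :
  (in_tuple [seq u * v | u <- vbasis U, v <- vbasis V])`_i \in
  [seq u * v | u <- vbasis U, v <- vbasis V] by apply: mem_nth.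
rewrite size_tuple in jV.
set a := coord _ _ _; exists (fun t => if t == Ordinal jV then a *: u else 0).
  by move=> t; case: ifP => _; rewrite ?mem0v // memvZ ?vbasis_mem.
rewrite (bigD1 (Ordinal jV)) //= eqxx big1 ?addr0 ?ffun_scalerAl //.
move=> t /negPf->.
by rewrite mul0r.
Qed.

Lemma prodsp_suml U V f : f \in prodsp U V ->
  exists2 v : 'I_(\dim U) -> W,
    forall t, v t \in V & f = \sum_(t < \dim U) ((vbasis U)`_t * v t : W).
Proof.
rewrite prodspC => /prodsp_sumr[v vV ->]; exists v => //.
by apply: eq_bigr => t _; rewrite ffun_mulC.
Qed.

Lemma prodspA U V Z : prodsp U (prodsp V Z) = prodsp (prodsp U V) Z.
Proof.
apply/subv_anti/andP; split; apply/prodsp_subP => f g.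
  move=> fU /prodsp_sumr[v vV ->]; rewrite mulr_sumr; apply: memv_suml => t _.
  by rewrite mulrA !mem_prodsp // mem_nth_vbasis.
move=> /prodsp_suml[v vV ->] gZ; rewrite mulr_suml; apply: memv_suml => t _.
by rewrite -mulrA !mem_prodsp // mem_nth_vbasis.
Qed.

Lemma prodsp_suml_sub (J : finType) (P : pred J) (U : J -> {vspace W}) V K :
  (forall i, P i -> prodsp (U i) V <= K)%VS ->
  (prodsp (\sum_(i | P i) U i)%VS V <= K)%VS.
Proof.
move=> sub; apply/prodsp_subP => _ v /memv_sumP[u uU ->] vV.
rewrite mulr_suml; apply: memv_suml => i Pi.
by apply: (subvP (sub i Pi)); apply: mem_prodsp => //; apply: uU.
Qed.

End ProductSpace.

(** * Functions of disjoint sets of coordinates are linearly disjoint *)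

Section Local.

Variables (k : fieldType) (I : finType) (Y : finType).
Notation X := {ffun I -> Y}.
Notation W := {ffun X -> k^o}.

Definition local (A : {set I}) (f : W) :=
  forall x y : X, (forall i, i \in A -> x i = y i) -> f x = f y.

Variables A B : {set I}.
Hypothesis AB : [disjoint A & B].

(* A function of the coordinates in [A] and one of the coordinates in [B] can
   be evaluated at independent points [x] and [z]. *)
Lemma local_free m (u : m.-tuple W) (v : 'I_m -> W) :
    free u -> (forall t : 'I_m, local A u`_t) -> (forall t, local B (v t)) ->
    \sum_(t < m) (u`_t * v t : W) = 0 ->
  forall t, v t = 0.
Proof.
move=> /freeP uf uA vB uv0 t; apply/ffunP => z; rewrite ffunE.
(* For fixed [z] the scalars [v t z] are the coefficients of a linear relation on [u]: at [x] it is
   the given relation at the point [w] that equals [x] on [A] and [z] elsewhere. *)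
apply: (uf (fun t => v t z)) => {t}; apply/ffunP => x.
pose w : X := [ffun i => if i \in A then x i else z i].
have := congr1 (fun f : W => f w) uv0; rewrite /= sum_ffunE !ffunE => <-.
rewrite sum_ffunE; apply: eq_bigr => t _; rewrite !ffunE [LHS]mulrC.
congr (_ * _); first by apply: uA => i iA; rewrite ffunE iA.
by apply: vB => i iB; rewrite ffunE ifN // (disjointFl AB).
Qed.

(** Coefficient arrays map onto [prodsp U V]; the map is injective by [local_free] for the basis of
    [U], followed by freeness of the basis of [V]. *)
Lemma dim_prodsp (U V : {vspace W}) :
  (forall f, f \in U -> local A f) ->
  (forall f, f \in V -> local B f) ->
  \dim (prodsp U V) = (\dim U * \dim V)%N.
Proof.
move=> UA VB.
pose v (f : {ffun 'I_(\dim U) * 'I_(\dim V) -> k^o}) t : W :=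
  \sum_(s < \dim V) f (t, s) *: (vbasis V)`_s.
pose phi (f : {ffun 'I_(\dim U) * 'I_(\dim V) -> k^o}) : W :=
  \sum_(t < \dim U) ((vbasis U)`_t * v f t : W).
have phi_lin : linear phi.
  move=> a f g; rewrite scaler_sumr -big_split; apply: eq_bigr => t _ /=.
  rewrite ffun_scalerAr -mulrDr; congr (_ * _).
  rewrite scaler_sumr -big_split; apply: eq_bigr => s _ /=.
  by rewrite !ffunE scalerDl scalerA.
pose L := GRing.isLinear.Build _ _ _ _ _ phi_lin.
pose Phi : {linear {ffun 'I_(\dim U) * 'I_(\dim V) -> k^o} -> W} :=
  HB.pack phi L.
have vV f t : v f t \in V.
  by apply: memv_suml => s _; apply/memvZ/mem_nth_vbasis.
have Phi_inj : lker (linfun Phi) == 0%VS.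
  rewrite -subv0; apply/subvP => f; rewrite memv_ker lfunE memv0 /= => /eqP f0.
  apply/eqP/ffunP => -[t s]; rewrite ffunE.
  have := local_free (basis_free (vbasisP U)) (fun t => UA _ (mem_nth_vbasis (U := U) t))
    (fun t => VB _ (vV f t)) f0 t.
  have /freeP fV := basis_free (vbasisP V).
  by move=> vt0; apply: (fV (fun s => f (t, s))).
have <- : limg (linfun Phi) = prodsp U V.
  apply/subv_anti/andP; split.
    apply/subvP => _ /memv_imgP[f _ ->]; rewrite lfunE.
    apply: memv_suml => t _; apply: mem_prodsp => //.
    exact: mem_nth_vbasis.
  apply/subvP => _ /prodsp_suml[w wV ->].
  apply/memv_imgP; exists [ffun p => coord (vbasis V) p.2 (w p.1)].
    exact: memvf.
  rewrite lfunE; apply: eq_bigr => t _; congr (_ * _).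
  rewrite [LHS](coord_vbasis (wV t)); apply: eq_bigr => s _.
  by rewrite ffunE.
rewrite limg_dim_eq ?(eqP Phi_inj) ?capv0 // dimvf /dim /=.
by rewrite card_prod !card_ord muln1.
Qed.

End Local.

(** * Tensors as functions on a common space of points *)

Section Pull.

Variables (k : fieldType) (I : finType) (V : I -> vectType k).

(* Large enough to contain the coordinates of every multi-index; the points
   outside the range of a family carry the value [0], so that [pull A] stays
   injective even when some [V i] with [i \notin A] is [0]. *)
Definition points : finType := {ffun I -> 'I_(\max_i \dim {:V i}).+1}.
Notation W := {ffun points -> k^o}.
Implicit Type x : points.

Section OneSet.

Variable A : {set I}.
Implicit Type y : mindex (@subfam k I V A).

Definition agrees (x : points) (y : mindex (@subfam k I V A)) : bool :=
  [forall l, x (val l) == y l :> nat].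

(** At most one [y] agrees with [x], so the value is the coordinate of [t] at the restriction of [x]
    to [A], or [0] if that restriction is out of range. *)
Definition pullf (t : tensOn V A) : W :=
  [ffun x => \sum_(y | agrees x y) tens_coef t y].

Fact pullf_linear : linear pullf.
Proof.
move=> a t u; apply/ffunP => x; rewrite !ffunE scaler_sumr -big_split.
by apply: eq_bigr => y _; rewrite /tens_coef !ffunE.
Qed.
HB.instance Definition _ := GRing.isLinear.Build k (tensOn V A) W _ pullf
  pullf_linear.

Definition pull : 'Hom(tensOn V A, W) := linfun pullf.

Lemma agreesP x y : reflect (forall l, x (val l) = y l :> nat) (agrees x y).
Proof. by apply: (iffP forallP) => xy l; apply/eqP. Qed.

Lemma agrees_uniq x y z : agrees x y -> agrees x z -> y = z.
Proof.
move=> /agreesP xy /agreesP xz; apply/ffunP => l; apply/val_inj.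
by rewrite /= -xy -xz.
Qed.

Lemma pull_agrees x y t : agrees x y -> pull t x = tens_coef t y.
Proof.
move=> xy; rewrite lfunE /= ffunE (bigD1 y) //= big1 ?addr0 // => z /andP[xz].
by rewrite (agrees_uniq xy xz) eqxx.
Qed.

Lemma pull_eq0 x t : (forall y, ~~ agrees x y) -> pull t x = 0.
Proof.
by move=> xN; rewrite lfunE /= ffunE big1 // => y; rewrite (negPf (xN y)).
Qed.

Lemma agrees_ex y : exists x, agrees x y.
Proof.
exists [ffun i => if insub i is Some l then inord (y l) else ord0].
apply/agreesP => l; rewrite ffunE valK inordK // ltnS.
by apply: leq_trans (ltnW (ltn_ord _)) _; apply: (leq_bigmax (val l)).
Qed.

Lemma pull_inj : injective pull.
Proof.
move=> t u tu; apply/ffunP => y; have [x xy] := agrees_ex y.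
by have := congr1 (fun f : W => f x) tu; rewrite /= !(pull_agrees _ xy).
Qed.

Lemma lker_pull : lker pull == 0%VS.
Proof. exact/lker0P/pull_inj. Qed.

Lemma pull_local t : local A (pull t).
Proof.
move=> x x' xx'; rewrite lfunE /= !ffunE; apply: eq_bigl => y.
by apply: eq_forallb => l; rewrite xx' ?(valP l).
Qed.

Lemma mem_pull t (U : {vspace tensOn V A}) :
  (pull t \in (pull @: U)%VS) = (t \in U).
Proof.
by apply/memv_imgP/idP => [[u uU /pull_inj->]|tU] //; exists t.
Qed.

Lemma dim_pull (U : {vspace tensOn V A}) : \dim (pull @: U) = \dim U.
Proof. by rewrite limg_dim_eq // (eqP lker_pull) capv0. Qed.

End OneSet.

(** The empty tensor product is the ground field: there is one multi-index and every point agrees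
    with it, so the functions obtained are the constants. *)
Lemma limg_pull0 A : A = set0 -> limg (pull A) = <[1 : W]>%VS.
Proof.
move=> A0; have noA (l : {l | l \in A}) : False.
  by case: l => i; rewrite A0 inE.
pose y0 : mindex (@subfam k I V A) := [ffun l => False_rect _ (noA l)].
have ag x : agrees x y0 by apply/agreesP => l; case: (noA l).
apply/subv_anti/andP; split; apply/subvP.
  move=> _ /memv_imgP[t _ ->]; apply/vlineP; exists (tens_coef t y0).
  by apply/ffunP => x; rewrite (pull_agrees _ (ag x)) !ffunE [RHS]mulr1.
move=> _ /vlineP[a ->]; apply/memv_imgP; exists [ffun=> a]; first exact: memvf.
apply/ffunP => x; rewrite (pull_agrees _ (ag x)) /tens_coef !ffunE.
by rewrite [LHS]mulr1.
Qed.

Section PullMerge.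

Variables (C : {set I}) (B : finType) (A : B -> {set I}).
Hypothesis sAC : forall b, A b \subset C.
Hypothesis A_cover : forall i, i \in C -> exists b, i \in A b.

(** This turns the canonical map into pointwise multiplication. At a point in range on [C] both
    sides are the same product of coordinates; elsewhere both vanish. *)
Lemma pull_merge (u : forall b, tensOn V (A b)) :
  pull C (Defs.merge sAC u) = \prod_b pull (A b) (u b).
Proof.
apply/ffunP => x; rewrite ffun_prodE.
have [y xy|xN] := pickP (agrees (A := C) x).
  rewrite (pull_agrees _ xy) /tens_coef ffunE; apply: eq_bigr => b _.
  apply/esym/pull_agrees/agreesP => l; rewrite ffunE.
  exact: (agreesP _ _ xy (incl (sAC b) l)).
rewrite pull_eq0 => [|y]; last by rewrite xN.
(* Some coordinate [l] of [x] in [C] is out of range, and it kills the factor of the block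
   containing [l]. *)
have /existsP[l xl] :
    [exists l : {l | l \in C}, (\dim {:V (val l)} <= x (val l))%N].
  apply: contraT; rewrite negb_exists => /forallP lt.
  have lt' (l : {l | l \in C}) : (x (val l) < \dim {:@subfam k I V C l})%N.
    by rewrite ltnNge; apply: lt.
  by have /agreesP[] := xN [ffun l => Ordinal (lt' l)] => l; rewrite ffunE.
have [b lb] := A_cover (valP l).
rewrite (bigD1 b) //= pull_eq0 ?mul0r // => y; apply/agreesP.
move=> /(_ (exist _ (val l) lb)) /= xyl.
by have := ltn_ord (y (exist _ (val l) lb)); rewrite -xyl ltnNge xl.
Qed.

Hypothesis A_disj : forall b c i, i \in A b -> i \in A c -> b = c.

Lemma pull_ptens (v : forall l, @subfam k I V C l) :
  pull C (ptens v) =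
  \prod_b pull (A b) (ptens (fun l : {l | l \in A b} => v (incl (sAC b) l))).
Proof. by rewrite -(merge_ptens sAC) // pull_merge. Qed.

End PullMerge.

End Pull.

(** * The group action and the invariants, transported to functions *)

Section InvariantFunctions.

Variables (k : fieldType) (G : finGroupType) (I : finType).
Variable M : I -> kGmodule k G.
Notation W := {ffun points M -> k^o}.

Definition tens_fun (A : {set I}) : {vspace W} := limg (pull M A).
Definition inv_fun (A : {set I}) : {vspace W} :=
  (pull M A @: invariants M A)%VS.
(** The inverse is only a left inverse of [pull M A], so this is the action on [tens_fun A] and has
    no meaning outside it. *)
Definition fun_act (A : {set I}) (s : G) : 'End(W) :=
  (pull M A \o diag_act M A s \o (pull M A)^-1)%VF.

Lemma fun_actE A s t : fun_act A s (pull M A t) = pull M A (diag_act M A s t).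
Proof. by rewrite !comp_lfunE lker0_lfunK // lker_pull. Qed.

Lemma inv_fun_sub A : (inv_fun A <= tens_fun A)%VS.
Proof. exact/limgS/subvf. Qed.

Lemma fun_act_tens A s w : w \in tens_fun A -> fun_act A s w \in tens_fun A.
Proof. by move=> /memv_imgP[t _ ->]; rewrite fun_actE mem_pull memvf. Qed.

Lemma inv_funP A w : w \in tens_fun A ->
  (forall s, fun_act A s w = w) <-> w \in inv_fun A.
Proof.
move=> /memv_imgP[t _ ->]; rewrite mem_pull; split=> [inv|/invariantsP inv s].
  by apply/invariantsP => s; apply: (@pull_inj _ _ M A); rewrite -fun_actE.
by rewrite fun_actE inv.
Qed.

Lemma tens_fun_local A f : f \in tens_fun A -> local A f.
Proof. by move=> /memv_imgP[t _ ->]; apply: pull_local. Qed.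

Lemma tens_fun0 A : A = set0 -> tens_fun A = <[1 : W]>%VS.
Proof. exact: limg_pull0. Qed.

Lemma inv_fun0 A : A = set0 -> (1 : W) \in inv_fun A.
Proof.
move=> A0; have noA (l : {l | l \in A}) : False.
  by case: l => i; rewrite A0 inE.
(* The empty set is covered by no blocks at all, so that [pull_ptens] yields an empty product. *)
have sA (b : void) : set0 \subset A by case: b.
have <- : pull M A (ptens (fun l : {l | l \in A} => 0 : subfam M l)) = 1.
  rewrite (pull_ptens sA); [by rewrite big1 // => -[]| |by case].
  by move=> i; rewrite A0 inE.
rewrite mem_pull; apply/invariantsP => s; rewrite [LHS]tens_mapE.
by congr ptens; apply: functional_extensionality_dep => l; case: (noA l).
Qed.

Section TwoBlocks.

Variables (C : {set I}) (A : bool -> {set I}).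
Hypothesis sAC : forall b, A b \subset C.
Hypothesis A_cover : forall i, i \in C -> exists b, i \in A b.
Hypothesis A_disj : forall b c i, i \in A b -> i \in A c -> b = c.

Lemma pull_merge2 (u : forall b, tensOn M (A b)) :
  pull M C (Defs.merge sAC u) =
  pull M (A false) (u false) * pull M (A true) (u true).
Proof. by rewrite pull_merge // ffun_prod_bool. Qed.

Definition two_blocks (t : tensOn M (A false)) (u : tensOn M (A true)) b :
  tensOn M (A b) := if b is true then u else t.

Lemma tens_fun_mul :
  prodsp (tens_fun (A false)) (tens_fun (A true)) = tens_fun C.
Proof.
apply/subv_anti/andP; split.
  apply/prodsp_subP => _ _ /memv_imgP[t _ ->] /memv_imgP[u _ ->].
  by rewrite -(pull_merge2 (two_blocks t u)) mem_pull memvf.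
apply/subvP => _ /memv_imgP[t _ ->]; rewrite [t]tens_sum linear_sum.
apply: memv_suml => x _; rewrite linearZ; apply: memvZ.
rewrite [X in X \in _](pull_ptens sAC) // ffun_prod_bool.
by rewrite mem_prodsp // mem_pull memvf.
Qed.

Lemma fun_act_mul s u v : u \in tens_fun (A false) -> v \in tens_fun (A true) ->
  fun_act C s (u * v) = fun_act (A false) s u * fun_act (A true) s v.
Proof.
move=> /memv_imgP[t _ ->] /memv_imgP[t' _ ->].
rewrite -(pull_merge2 (two_blocks t t')) !fun_actE diag_act_merge //.
by rewrite pull_merge2.
Qed.

(** Both sides are spanned by products of pulled-back invariants. The proof [sAC'] is arbitrary so
    that the lemma applies to the one occurring in [composite]. *)
Lemma pull_canon (sAC' : forall b, A b \subset C) :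
  (pull M C @: limg (canon sAC' (fun b => invariants M (A b))))%VS =
  prodsp (inv_fun (A false)) (inv_fun (A true)).
Proof.
have -> : sAC' = sAC.
  by apply: functional_extensionality_dep => b; apply: bool_irrelevance.
apply/subv_anti/andP; split; last first.
  apply/prodsp_subP => _ _ /memv_imgP[t tI ->] /memv_imgP[u uI ->].
  rewrite -(pull_merge2 (two_blocks t u)) mem_pull.
  pose z b : subvs_of (invariants M (A b)) :=
    if b is true then Subvs uI else Subvs tI.
  apply/memv_imgP; exists (ptens z); first exact: memvf.
  rewrite canonE; congr Defs.merge.
  by apply: functional_extensionality_dep => -[].
apply/subvP => _ /memv_imgP[_ /memv_imgP[t _ ->] ->].
rewrite [canon _ _ _]tlift_sum linear_sum; apply: memv_suml => x _.
rewrite linearZ; apply: memvZ.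
by rewrite [X in X \in _]pull_merge2 mem_prodsp // mem_pull subvsP.
Qed.

End TwoBlocks.

End InvariantFunctions.

(** * Invariants over intervals and their first irreducible factor *)

Section Intervals.

Variables (k : fieldType) (G : finGroupType) (n : nat).
Variables (M : 'I_n -> kGmodule k G) (Irr : irr_choice M).
Notation W := {ffun points M -> k^o}.

(* The interval [(a, b]] corresponds to the factors M_b (x) ... (x) M_(a+1). *)
Definition tensI (a b : nat) : {vspace W} := tens_fun M (seg n b a.+1).
Definition invI (a b : nat) : {vspace W} := inv_fun M (seg n b a.+1).
Definition irrI (a b : nat) : {vspace W} :=
  (pull M (seg n b a.+1) @: Irr b a.+1)%VS.
Definition compI (a b : nat) : {vspace W} :=
  (pull M (seg n b a.+1) @: composite M b a.+1)%VS.
Definition actI (a b : nat) (s : G) : 'End(W) := fun_act M (seg n b a.+1) s.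

Lemma cutI_sub a b c : (a <= b <= c)%N ->
  forall e, cut n c a.+1 b e \subset seg n c a.+1.
Proof.
move=> /andP[ab bc] [] /=; apply/subsetP => m; rewrite !inE => /andP[m1 m2].
  by rewrite m2 (leq_trans _ m1).
by rewrite m1 (leq_trans m2).
Qed.

Lemma cutI_cover a b c i :
  i \in seg n c a.+1 -> exists e, i \in cut n c a.+1 b e.
Proof.
rewrite inE => /andP[ai ic]; case: (leqP i.+1 b) => ib.
  by exists false; rewrite inE ai ib.
by exists true; rewrite inE ib ic.
Qed.

Lemma cutI_disj a b c e e' i :
  i \in cut n c a.+1 b e -> i \in cut n c a.+1 b e' -> e = e'.
Proof.
by case: e e' => [] [] //; rewrite !inE => /andP[h1 h2] /andP[h3 h4];
  [have := leq_trans h1 h4 | have := leq_trans h3 h2]; rewrite ltnn.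
Qed.

Lemma seg_disjoint a b c : [disjoint seg n b a.+1 & seg n c b.+1].
Proof.
apply/pred0P => i; rewrite !inE; apply/negP => /andP[/andP[_ ib] /andP[bi _]].
by have := leq_trans bi ib; rewrite ltnn.
Qed.

Lemma seg0 a : seg n a a.+1 = set0.
Proof.
by apply/setP => i; rewrite !inE; case: leqP => //; rewrite ltnNge => /negPf.
Qed.

Lemma tensI_mul a b c : (a <= b <= c)%N ->
  prodsp (tensI a b) (tensI b c) = tensI a c.
Proof.
move=> abc.
exact: (tens_fun_mul M (cutI_sub abc) (@cutI_cover a b c) (@cutI_disj a b c)).
Qed.

Lemma tensI_nil a : tensI a a = <[1 : W]>%VS.
Proof. exact/tens_fun0/seg0. Qed.

Lemma invI_sub a b : (invI a b <= tensI a b)%VS.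
Proof. exact: inv_fun_sub. Qed.

Lemma invI_nil a : invI a a = <[1 : W]>%VS.
Proof.
apply/subv_anti; rewrite -[X in (X <= _ <= _)%VS]/(invI a a).
by rewrite -{1}(tensI_nil a) invI_sub -memvE; apply/inv_fun0/seg0.
Qed.

Lemma invIP a b w : w \in tensI a b ->
  (forall s, actI a b s w = w) <-> w \in invI a b.
Proof. exact: inv_funP. Qed.

Lemma actI_tens a b s w : w \in tensI a b -> actI a b s w \in tensI a b.
Proof. exact: fun_act_tens. Qed.

Lemma actI_mul a b c s u v : (a <= b <= c)%N ->
  u \in tensI a b -> v \in tensI b c ->
  actI a c s (u * v) = actI a b s u * actI b c s v.
Proof.
move=> abc.
exact: (fun_act_mul (cutI_sub abc) (@cutI_cover a b c) (@cutI_disj a b c)).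
Qed.

Lemma invI_mul a b c : (a <= b <= c)%N ->
  (prodsp (invI a b) (invI b c) <= invI a c)%VS.
Proof.
move=> abc; apply/prodsp_subP => u v uI vI.
have [uT vT] := (subvP (invI_sub _ _) _ uI, subvP (invI_sub _ _) _ vI).
apply/invIP => [|s]; first by rewrite -(tensI_mul abc) mem_prodsp.
rewrite (actI_mul s abc) //; congr (_ * _).
  exact: (iffRL (invIP uT)).
exact: (iffRL (invIP vT)).
Qed.

Lemma compIE a c :
  compI a c = (\sum_(b : {b : 'I_c | (a < b)%N})
    prodsp (invI a (val b)) (invI (val b) c))%VS.
Proof.
rewrite [LHS]limg_sum; apply: eq_bigr => -[b ab] _ /=.
have abc : (a <= b <= c)%N by rewrite (ltnW ab) ltnW.
exact: (pull_canon M (cutI_sub abc) (@cutI_cover a b c)).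
Qed.

Lemma compI_mul a b c : (a < b < c)%N ->
  (prodsp (invI a b) (invI b c) <= compI a c)%VS.
Proof.
move=> /andP[ab bc]; rewrite compIE.
exact: (sumv_sup (exist _ (Ordinal bc) ab)).
Qed.

Lemma irrI_compI a c : (a < c <= n)%N ->
  (irrI a c + compI a c = invI a c)%VS /\ (irrI a c :&: compI a c = 0)%VS.
Proof.
move=> /andP[ac cn]; have [irrD irrI0] := irrP Irr (ltn0Sn a) ac cn.
split; first by rewrite -limgD irrD.
by rewrite -lker0_img_cap ?lker_pull // irrI0 limg0.
Qed.

Lemma irrI_sub a c : (a < c <= n)%N -> (irrI a c <= invI a c)%VS.
Proof. by case/irrI_compI => <- _; apply: addvSl. Qed.

(* Invariance is tested on the right factor only: the action is linear over
   invariant left factors, and these are free over the right ones. *)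
Lemma prodsp_invI a b c (U : {vspace W}) x : (a <= b <= c)%N ->
    (U <= invI a b)%VS -> x \in prodsp U (tensI b c) ->
    (forall s, actI a c s x = x) ->
  x \in prodsp U (invI b c).
Proof.
move=> abc /subvP UI /prodsp_suml[v vT ->] inv; apply: memv_suml => t _.
have uU := @mem_nth_vbasis _ _ U.
have uT r := subvP (invI_sub a b) _ (UI _ (uU r)).
apply: mem_prodsp => //; apply/invIP => // s.
(* The differences between the translate of [v t] by [s] and [v t] are the coefficients, on the
   basis of [U], of the same difference for [x], which is zero. *)
apply/eqP; rewrite -subr_eq0; apply/eqP; move: t.
apply: (local_free (seg_disjoint a b c) (basis_free (vbasisP U))).
- by move=> r; apply/tens_fun_local/uT.
- by move=> r; apply/tens_fun_local/memvB => //; apply: actI_tens.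
have := inv s; rewrite linear_sum => /eqP; rewrite -subr_eq0 -sumrB => /eqP.
move=> inv0; rewrite -[RHS]inv0; apply: eq_bigr => r _.
rewrite [X in _ = X - _](actI_mul s abc) //.
by rewrite (iffRL (invIP (uT r))) ?mulrBr // UI.
Qed.

Lemma actI_prodsp a b c s (U : {vspace W}) x : (a <= b <= c)%N ->
    (U <= invI a b)%VS -> x \in prodsp U (tensI b c) ->
  actI a c s x \in prodsp U (tensI b c).
Proof.
move=> abc /subvP UI /prodsp_suml[v vT ->].
have uU := @mem_nth_vbasis _ _ U.
rewrite linear_sum; apply: memv_suml => t _.
have uT := subvP (invI_sub a b) _ (UI _ (uU t)).
rewrite [X in X \in _](actI_mul s abc) // mem_prodsp ?actI_tens //.
by rewrite (iffRL (invIP uT)) // UI.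
Qed.

(** The right factors are arbitrary tensors because the induction splits off the last tensor factor,
    which is possible for tensors but not for invariants. *)
Lemma irrI_tensI_free a m : (a + m <= n)%N -> forall x : 'I_m -> W,
    (forall d : 'I_m,
       x d \in prodsp (irrI a (a + d.+1)) (tensI (a + d.+1) (a + m))) ->
    \sum_d x d = 0 ->
  forall d, x d = 0.
Proof.
elim: m => [|m IH] amn x xP x0; first by case.
have amn' : (a + m <= n)%N by rewrite (leq_trans _ amn) // leq_add2l.
have irrS (d : 'I_m) : (irrI a (a + d.+1) <= invI a (a + d.+1))%VS.
  apply: irrI_sub; rewrite -[ltnLHS]addn0 ltn_add2l /=.
  by rewrite (leq_trans _ amn') // leq_add2l.
have lastE : (a + m <= a + m <= a + m.+1)%N by rewrite leqnn leq_add2l leqnSn.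
(* The terms other than the last are independent: expand them along a basis of the last tensor
   factor [L]. By [local_free] the coefficients of each basis vector sum to zero over [d], and the
   induction hypothesis applies to them. *)
have low (y : 'I_m -> W) : (forall d : 'I_m, y d \in
      prodsp (irrI a (a + d.+1)) (tensI (a + d.+1) (a + m.+1))) ->
    \sum_d y d = 0 -> forall d, y d = 0.
  move=> yP y0.
  set L := tensI (a + m) (a + m.+1).
  have zP (d : 'I_m) : exists z : 'I_(\dim L) -> W,
      (forall t, z t \in prodsp (irrI a (a + d.+1)) (tensI (a + d.+1) (a + m)))
      /\ y d = \sum_(t < \dim L) (z t * (vbasis L)`_t : W).
    have := yP d; rewrite -(@tensI_mul _ (a + m)) ?prodspA.
      by case/prodsp_sumr => z; exists z.
    by rewrite !leq_add2l ltn_ord leqnSn.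
  have [z {}zP] := fin_all_exists zP.
  suff z0 t : \sum_d z d t = 0.
    move=> d; have [zd ->] := zP d; rewrite big1 // => t _.
    by rewrite (IH amn' (z^~ t)) ?mul0r // => e; have [] := zP e.
  move: t.
  have dis : [disjoint seg n (a + m.+1) (a + m).+1 & seg n (a + m) a.+1].
    by rewrite disjoint_sym seg_disjoint.
  apply: (local_free dis (basis_free (vbasisP L))) => [t|t|].
  - exact/tens_fun_local/mem_nth_vbasis.
  - apply: tens_fun_local; apply: memv_suml => d _.
    have [zd _] := zP d; apply: (subvP _ _ (zd t)).
    rewrite -/(tensI a (a + m)) -(@tensI_mul a (a + d.+1)).
      by apply: prodspS => //; apply: subv_trans (irrS d) (invI_sub _ _).
    by rewrite leq_addr leq_add2l ltn_ord.
  rewrite -[RHS]y0 (eq_bigr _ (fun d _ => (zP d).2)) exchange_big /=.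
  apply: eq_bigr => t _; rewrite mulr_sumr; apply: eq_bigr => d _.
  exact: ffun_mulC.
move: x0; rewrite big_ord_recr /= => x0.
have lowP (d : 'I_m) : x (widen_ord (leqnSn m) d) \in
    prodsp (irrI a (a + d.+1)) (tensI (a + d.+1) (a + m.+1)).
  exact: xP.
have mid (d : 'I_m) : (a <= a + d.+1 <= a + m.+1)%N.
  by rewrite leq_addr leq_add2l ltnS ltnW.
have am : (a < a + m.+1 <= n)%N by rewrite amn -[ltnLHS]addn0 ltn_add2l.
(* For the last index the right factor belongs to the empty interval, hence is scalar. *)
have xI : x ord_max \in irrI a (a + m.+1).
  by have := xP ord_max; rewrite /= tensI_nil prodsp1.
have xE : \sum_(d < m) x (widen_ord (leqnSn m) d) = - x ord_max.
  by apply/eqP; rewrite -addr_eq0 x0.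
have xC : x ord_max \in compI a (a + m.+1).
  rewrite -memvN -xE; apply: memv_suml => d _.
  (* The sum of the lower terms is invariant, being minus the last term. So the differences between
     their translates and themselves sum to zero, and [low] makes each of them vanish. *)
  have inv_x s :
      actI a (a + m.+1) s (x (widen_ord (leqnSn m) d))
      = x (widen_ord (leqnSn m) d).
    apply/eqP; rewrite -subr_eq0; apply/eqP; move: d.
    apply: low => [d|]; first by rewrite memvB // actI_prodsp.
    rewrite sumrB -linear_sum xE linearN /= (iffRL (invIP _)) ?subrr //.
      exact: (subvP (subv_trans (irrI_sub am) (invI_sub _ _))).
    exact: (subvP (irrI_sub am)).
  (* An invariant term has an invariant right factor; its cut is interior since [d < m], so it is
     composite. *)
  have := prodsp_invI (mid d) (irrS d) (lowP d) inv_x.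
  apply/subvP; apply: subv_trans (compI_mul (b := a + d.+1) _); last first.
    by rewrite -[ltnLHS]addn0 !ltn_add2l /= ltnS.
  exact: prodspS.
have xmax : x ord_max = 0.
  apply/eqP; rewrite -memv0; have [_ <-] := irrI_compI am.
  by rewrite memv_cap xI.
move=> d; have [dm|] := ltnP d m; last first.
  move=> md; suff -> : d = ord_max by [].
  by apply/val_inj/eqP; rewrite eqn_leq md -ltnS ltn_ord.
have -> : d = widen_ord (leqnSn m) (Ordinal dm) by apply: val_inj.
by apply: low lowP _ _; rewrite xE xmax oppr0.
Qed.

(** The summands [S d] lie in [invI a (a + m)] and are independent by [irrI_tensI_free];
    disjointness of the two intervals makes dimensions multiply. *)
Lemma dim_invI_ge a m : (a + m <= n)%N ->
  (\sum_(d < m) \dim (irrI a (a + d.+1)) * \dim (invI (a + d.+1) (a + m))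
   <= \dim (invI a (a + m)))%N.
Proof.
move=> amn.
have am (d : 'I_m) : (a < a + d.+1 <= n)%N.
  by rewrite -[ltnLHS]addn0 ltn_add2l (leq_trans _ amn) // leq_add2l.
have mid (d : 'I_m) : (a <= a + d.+1 <= a + m)%N.
  by rewrite leq_addr leq_add2l /=.
pose S (d : 'I_m) := prodsp (irrI a (a + d.+1)) (invI (a + d.+1) (a + m)).
have dS : directv (\sum_d S d).
  apply/directv_sum_independent => x xS x0 d _.
  apply: (irrI_tensI_free amn) d => // d.
  by apply: (subvP _ _ (xS d isT)); apply: prodspS => //; apply: invI_sub.
have {dS} /= dimS := directvP dS.
suff -> : (\sum_(d < m)
   \dim (irrI a (a + d.+1)) * \dim (invI (a + d.+1) (a + m))
   = \dim (\sum_d S d)%VS)%N.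
  apply/dimvS/subv_sumP => d _; apply: subv_trans (invI_mul (mid d)).
  exact/prodspS/subvv/irrI_sub.
rewrite dimS; apply: eq_bigr => d _.
apply/esym/(dim_prodsp (seg_disjoint a (a + d.+1) (a + m))) => f fS.
  apply: tens_fun_local; apply: (subvP _ _ fS).
  exact: subv_trans (irrI_sub (am d)) (invI_sub _ _).
by apply: tens_fun_local; apply: (subvP _ _ fS); apply: invI_sub.
Qed.

(** A composite invariant is a sum of products cut at some [b]. By induction the left factor splits
    off an irreducible one, and what remains of it is absorbed into the right factor. *)
Lemma invI_sum_irrI a m : (0 < m)%N -> (a + m <= n)%N ->
  (invI a (a + m) <=
   \sum_(d < m) prodsp (irrI a (a + d.+1)) (invI (a + d.+1) (a + m)))%VS.
Proof.
elim/ltn_ind: m => m IH m0 amn.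
have am : (a < a + m <= n)%N by rewrite amn -[ltnLHS]addn0 ltn_add2l m0.
have [<- _] := irrI_compI am; rewrite subv_add; apply/andP; split.
  (* The irreducible part is the last summand, whose right factor is scalar. *)
  case: m m0 {IH am amn} => // m _; apply: (sumv_sup ord_max) => //=.
  by rewrite invI_nil prodsp1.
rewrite compIE; apply/subv_sumP => -[b ab] _ /=.
have [e bE] : exists e, b = (a + e)%N :> nat.
  by exists (b - a)%N; rewrite subnKC // ltnW.
have e0 : (0 < e)%N by rewrite bE -[ltnLHS]addn0 ltn_add2l in ab.
have em : (e < m)%N by have := ltn_ord b; rewrite bE ltn_add2l.
have aen : (a + e <= n)%N by rewrite (leq_trans _ amn) // leq_add2l ltnW.
rewrite bE; have sub := IH e em e0 aen.
apply: subv_trans (prodspS sub (subvv _)) _; apply: prodsp_suml_sub => d _.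
apply: (sumv_sup (widen_ord (ltnW em) d)) => //=.
rewrite -prodspA; apply: prodspS => //; apply: invI_mul.
by rewrite !leq_add2l ltn_ord ltnW.
Qed.

End Intervals.

(** * Iteration along compositions, and the basis of the invariants *)

Section Compositions.

Variables (k : fieldType) (G : finGroupType) (n : nat).
Variables (M : 'I_n -> kGmodule k G) (Irr : irr_choice M).
Notation W := {ffun points M -> k^o}.

(* [s] is a composition of the length of an interval [(a, c]]. *)
Definition irr_blockI (a : nat) (s : seq nat) (b : nat) : {vspace W} :=
  irrI Irr (a + sumn (take b s)) (a + sumn (take b.+1 s)).

Lemma irr_blockI_cons a e s b :
  irr_blockI a (e :: s) b.+1 = irr_blockI (a + e) s b.
Proof. by rewrite /irr_blockI /= !addnA. Qed.

(** The space [K] is arbitrary so that the induction can replace it by its preimage under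
    multiplication by the first factor [u0]. *)
Lemma invI_sub_irr_products a m (K : {vspace W}) : (a + m <= n)%N ->
    (forall (s : seq nat) (u : nat -> W), is_composition m s ->
       (forall b, (b < size s)%N -> u b \in irr_blockI a s b) ->
       \prod_(b < size s) u b \in K) ->
  (invI M a (a + m) <= K)%VS.
Proof.
elim/ltn_ind: m a K => -[|m] IH a K amn prodK.
  rewrite addn0 invI_nil -memvE.
  by have := prodK [::] (fun=> 0) isT; rewrite big_ord0; apply.
apply: subv_trans (invI_sum_irrI Irr _ amn) _ => //.
apply/subv_sumP => d _; apply/prodsp_subP => u0 v u0I.
have mulf_linear : linear (fun w : W => u0 * w : W).
  by move=> c f g; rewrite mulrDr ffun_scalerAr.
pose L := GRing.isLinear.Build _ _ _ _ _ mulf_linear.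
pose mulf : {linear W -> W} := HB.pack (fun w : W => u0 * w : W) L.
suff /subvP sub : (invI M (a + d.+1) (a + m.+1) <= linfun mulf @^-1: K)%VS.
  by move=> /sub; rewrite -memv_preim lfunE.
have dm : (d.+1 + (m - d) = m.+1)%N by rewrite addSn subnKC // -ltnS.
have mE : (a + m.+1 = a + d.+1 + (m - d))%N by rewrite -addnA dm.
rewrite [X in invI _ _ X]mE; apply: IH.
- by rewrite ltnS leq_subr.
- by rewrite -mE.
move=> s u /andP[s0 /eqP ssum] uI; rewrite -memv_preim lfunE /=.
have := prodK (d.+1 :: s) (fun b => if b is b'.+1 then u b' else u0).
rewrite big_ord_recl; apply.
  by rewrite /is_composition /= s0 ssum dm eqxx.
move=> [_|b bs]; last by rewrite irr_blockI_cons uI.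
by rewrite /irr_blockI /= addn0 take0 /= addn0.
Qed.

(** Iterates [dim_invI_ge], grouping the compositions by their first part. Any duplicate-free list
    is allowed, so the tails in a group form a list to which the induction hypothesis applies
    directly. *)
Lemma sum_dim_irr_products a m (r : seq (seq nat)) : (a + m <= n)%N -> uniq r ->
    all (is_composition m) r ->
  (\sum_(s <- r) \prod_(b < size s) \dim (irr_blockI a s b)
   <= \dim (invI M a (a + m)))%N.
Proof.
elim/ltn_ind: m a r => -[|m] IH a r amn r_uniq /allP rP.
  have dim1 : (0 < \dim (invI M a (a + 0)))%N.
    rewrite addn0 invI_nil dim_vline lt0b; apply/eqP => /ffunP/(_ [ffun=> ord0]).
    by rewrite !ffunE => /eqP; rewrite oner_eq0.
  have r0 s : s \in r -> s = [::].
    by case: s => // -[|d] s /rP; rewrite /is_composition //= andbF.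
  case: r r_uniq r0 {rP} => [|s [|s' r]] /=; first by rewrite big_nil.
    by move=> _ r0; rewrite big_seq1 (r0 s) ?inE // big_ord0.
  rewrite inE => /andP[/norP[ss' _] _] r0; case/eqP: ss'.
  by transitivity (Nil nat); [|apply/esym]; apply: r0; rewrite !inE eqxx ?orbT.
apply: leq_trans (dim_invI_ge Irr amn).
(* The first part minus one; parts of a composition of [m.+1] lie between [1] and [m.+1], so the
   default of [inord] is never reached on [r]. *)
pose p (s : seq nat) : 'I_m.+1 := inord (head 0%N s).-1.
rewrite (partition_big p predT) //=; apply: leq_sum => d _.
have dm : (d.+1 + (m - d) = m.+1)%N by rewrite addSn subnKC // -ltnS.
set r' := [seq s <- r | p s == d].
have r'P s : s \in r' ->
    s = d.+1 :: behead s /\ is_composition (m - d) (behead s).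
  rewrite mem_filter => /andP[/eqP psd /rP]; case: s psd => [|[|e] s] // psd.
  rewrite /is_composition /= => /andP[s0 /eqP es].
  have ed : e = d.
    by rewrite -psd /p /= inordK // ltnS -ltnS -es addSn ltnS leq_addr.
  split; first by rewrite ed.
  by rewrite s0 -(eqn_add2l d.+1) dm -ed es eqxx.
rewrite -big_filter -/r'.
rewrite (eq_big_seq (fun s => \dim (irrI Irr a (a + d.+1)) *
    \prod_(b < size (behead s)) \dim (irr_blockI (a + d.+1) (behead s) b))%N);
  last first.
  move=> s /r'P[+ _]; move: (behead s) => s' -> /=.
  rewrite big_ord_recl; congr (_ * _)%N.
    by rewrite /irr_blockI /= take0 /= !addn0.
  by apply: eq_bigr => b _; rewrite irr_blockI_cons.
rewrite -big_distrr leq_mul2l /=; apply/orP; right.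
rewrite -(big_map behead predT (fun s => \prod_(b < size s)
  \dim (irr_blockI (a + d.+1) s b))%N).
have mE : (a + m.+1 = a + d.+1 + (m - d))%N by rewrite -addnA dm.
rewrite [X in invI _ _ X]mE; apply: IH; first by rewrite ltnS leq_subr.
- by rewrite -mE.
- rewrite map_inj_in_uniq ?filter_uniq // => s t /r'P[s_eq _] /r'P[t_eq _] st.
  by rewrite s_eq t_eq st.
by apply/allP => _ /mapP[s /r'P[_ sP] ->].
Qed.

Section Psi.

Notation U p := (irr_block Irr (p := p)).
Notation index_p p := (mindex (fun b => subvs_of (U p b))).
Notation index := {p : composition n & index_p p}.

Definition irr_basis (p : composition n) (x : index_p p) : W :=
  pull M (seg n n 1) (canon (@block_sub n p) (U p) (ptens (basis_tuple x))).

Lemma card_index :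
  #|{: index}| =
  (\sum_(p : composition n) \prod_(b < size (parts p))
     \dim (irr_blockI 0 (parts p) b))%N.
Proof.
rewrite card_tagged sumnE big_map big_enum /=; apply: eq_bigr => p _.
rewrite card_dep_ffun foldrE big_map big_enum /=; apply: eq_bigr => b _.
by rewrite card_ord dimvf /dim /= dim_pull.
Qed.

(** In coordinates [psi] forms linear combinations of the [irr_basis] vectors, so its bijectivity
    amounts to their being a basis of the invariants. *)
Lemma pull_psi t :
  pull M (seg n n 1) (vsval (psi Irr t)) =
  \sum_(z : index) tens_coef (dirsum_fun t (tag z)) (tagged z) *:
    irr_basis (tagged z).
Proof.
transitivity (\sum_(p : composition n) \sum_x tens_coef (dirsum_fun t p) x *:
    irr_basis x); last by rewrite sig_big_dep /=; apply: eq_bigr => -[].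
rewrite /psi !linear_sum; apply: eq_bigr => p _ /=.
rewrite [dirsum_fun t p in LHS]tens_sum !linear_sum; apply: eq_bigr => x _.
by rewrite !linearZ.
Qed.

Definition irr_basis_tuple : #|{: index}|.-tuple W :=
  [tuple irr_basis (tagged (enum_val i)) | i < #|{: index}|].

Lemma irr_basis_tupleE (i : 'I_#|{: index}|) :
  irr_basis_tuple`_i = irr_basis (tagged (enum_val i)).
Proof. by rewrite -tnth_nth tnth_mktuple. Qed.

(** A spanning family with no more members than the dimension is a basis, so independence follows
    from the count. *)
Lemma irr_basisP : basis_of (invI M 0 n) irr_basis_tuple.
Proof.
rewrite basisEdim size_tuple; apply/andP; split; last first.
  rewrite card_index -[X in (X <= _)%N](big_map (@parts n) predT (fun s =>
    \prod_(b < size s) \dim (irr_blockI 0 s b))%N).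
  apply: (sum_dim_irr_products (m := n)) => //.
    by rewrite map_inj_uniq ?index_enum_uniq //; apply: parts_inj.
  by apply/allP => _ /mapP[p _ ->]; apply: valP p.
(* A product of irreducible invariants is the image of a pure tensor under the canonical map;
   expanding that tensor in basis tensors gives a combination of [irr_basis] vectors. *)
apply: (invI_sub_irr_products (m := n)) => // _ u /parts_surj[p <-] uI.
have vP (b : 'I_(size (parts p))) : exists v : subvs_of (U p b),
    u b = pull M (block b) (vsval v).
  have /memv_imgP[v vU ->] := uI b (ltn_ord b).
  by exists (Subvs vU).
have [v vE] := fin_all_exists vP.
rewrite (eq_bigr _ (fun b _ => vE b)).
rewrite -(pull_merge (@block_sub n p)); last first.
  move=> i; rewrite inE => /andP[_ i_n]; have [|b bi] := @parts_cover n p i.+1.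
    by [].
  by exists b; rewrite inE.
rewrite -canonE [ptens v]tens_sum !linear_sum; apply: memv_suml => x _.
rewrite !linearZ; apply/memvZ/memv_span.
have xE : irr_basis_tuple`_(enum_rank (Tagged (fun p => index_p p) x)) =
    irr_basis x.
  by rewrite irr_basis_tupleE enum_rankK.
rewrite -[X in X \in _]/(irr_basis x) -xE.
by apply: mem_nth; rewrite size_tuple.
Qed.

Lemma pull_psi_tuple t :
  pull M (seg n n 1) (vsval (psi Irr t)) =
  \sum_(i < #|{: index}|)
    tens_coef (dirsum_fun t (tag (enum_val i))) (tagged (enum_val i)) *:
    irr_basis_tuple`_i.
Proof.
rewrite pull_psi (reindex (@enum_val _ {: index})) /=; last first.
  by exists enum_rank => z _; rewrite ?enum_valK ?enum_rankK.
by apply: eq_bigr => i _; rewrite irr_basis_tupleE.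
Qed.

Definition psi_inv (w : subvs_of (invM M n 1)) : dirsum (tens_irr Irr) :=
  mk_dirsum (fun p => [ffun x : index_p p =>
    coord irr_basis_tuple (enum_rank (Tagged (fun p => index_p p) x))
      (pull M (seg n n 1) (vsval w)) : k^o] : tens_irr Irr p).

Lemma psiK : cancel (psi Irr) psi_inv.
Proof.
move=> t; apply: dirsumP => p; apply/ffunP => x.
rewrite mk_dirsumE ffunE pull_psi_tuple coord_sum_free ?enum_rankK //.
exact: basis_free irr_basisP.
Qed.

Lemma psi_invK : cancel psi_inv (psi Irr).
Proof.
move=> w; apply/val_inj/(@pull_inj _ _ M (seg n n 1)).
rewrite pull_psi_tuple [RHS](coord_basis irr_basisP); last first.
  by rewrite mem_pull subvsP.
apply: eq_bigr => i _; rewrite /tens_coef mk_dirsumE ffunE.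
congr (coord _ _ _ *: _).
by rewrite -[RHS]enum_valK; case: (enum_val i).
Qed.

End Psi.

End Compositions.

Theorem theorem3p9 (k : fieldType) (G : finGroupType) (n : nat) (hn : (1 <= n)%N)
    (M : 'I_n -> kGmodule k G) (Irr : irr_choice M) :
  bijective (psi Irr : {linear dirsum (tens_irr Irr) -> subvs_of (invM M n 1)}).
Proof.
by exists (psi_inv Irr); [apply: psiK|apply: psi_invK].
Qed.
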